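(* Let $g,h:\mathbb{N}\to\mathbb{C}$ be completely multiplicative arithmetic functions and let $f=g*h$ (Dirichlet convolution of functions of one variable), i.e. $f(n)=\sum_{d\mid n} g(d)h(n/d)$. Let $r\in\mathbb{N}$ and let $\psi_f:\mathbb{N}^r\to\mathbb{C}$ be the multiplicative function of $r$ variables defined, for every prime $p$ and every $\nu_1,\ldots,\nu_r\in\mathbb{N}_0$, by \[ \psi_f(p^{\nu_1},\ldots,p^{\nu_r})= \begin{cases} 1, & \nu_1=\cdots=\nu_r=0,\\ (-1)^{j-1} g(p)h(p)f(p^{j-2}), & \nu_1,\ldots,\nu_r\in \{0,1\} \text{ and } j:=\nu_1+\cdots+\nu_r \ge 2,\\ 0, & \text{otherwise}. \end{cases} \] Let $\psi_f^{-1_*}$ be the inverse of $\psi_f$ under the $r$-variable Dirichlet convolution. Then for every $n_1,\ldots,n_r\in\mathbb{N}$, \[ f(n_1\cdots n_r) = \sum_{a_1\mid n_1, \, \ldots, \, a_r\mid n_r} f\left(\frac{n_1}{a_1}\right)\cdots f\left(\frac{n_r}{a_r}\right)\psi_f(a_1,\ldots,a_r), \] and \[ f(n_1)\cdots f(n_r) = \sum_{a_1\mid n_1,\, \ldots,\, a_r\mid n_r} f\left(\frac{n_1\cdots n_r}{a_1\cdots a_r} \right)\psi_f^{-1_*}(a_1,\ldots,a_r). \]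
   Context: $\mathbb{N}=\{1,2,\ldots\}$, $\mathbb{N}_0=\{0,1,2,\ldots\}$. For functions $F,G:\mathbb{N}^r\to\mathbb{C}$, the $r$-variable Dirichlet convolution is $(F*G)(n_1,\ldots,n_r)=\sum_{a_1\mid n_1,\ldots,a_r\mid n_r}F(a_1,\ldots,a_r)G(n_1/a_1,\ldots,n_r/a_r)$; its identity is $\delta$ with $\delta(1,\ldots,1)=1$ and $\delta(n_1,\ldots,n_r)=0$ if $n_1\cdots n_r>1$, and $F$ has an inverse $F^{-1_*}$ (with $F*F^{-1_*}=\delta$) iff $F(1,\ldots,1)\neq 0$. A function $F:\mathbb{N}^r\to\mathbb{C}$ is multiplicative if it is not identically zero and $F(m_1n_1,\ldots,m_rn_r)=F(m_1,\ldots,m_r)F(n_1,\ldots,n_r)$ whenever $\gcd(m_1\cdots m_r,n_1\cdots n_r)=1$; such $F$ satisfies $F(1,\ldots,1)=1$ and $F(n_1,\ldots,n_r)=\prod_p F(p^{\nu_p(n_1)},\ldots,p^{\nu_p(n_r)})$, so it is determined by its values at tuples of powers of the same prime. *)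

(* Defs.v *)
From HB Require Import structures.
From mathcomp Require Import all_boot all_order all_algebra.
From mathcomp Require Import reals complex.

Set Implicit Arguments.
Unset Strict Implicit.
Unset Printing Implicit Defensive.

Import GRing.Theory.
Local Open Scope ring_scope.

(* Arithmetic functions of one variable are functions on nat, and those of r
   variables are functions on {ffun 'I_r -> nat}; only their values at positive
   arguments are meaningful, so all properties are restricted to those. *)

Definition completely_multiplicative (K : comNzRingType) (g : nat -> K) : Prop :=
  (exists2 n, (0 < n)%N & g n != 0) /\
  (forall m n, (0 < m)%N -> (0 < n)%N -> g (m * n)%N = g m * g n).

Definition dconv (K : comNzRingType) (g h : nat -> K) (n : nat) : K :=
  \sum_(d <- divisors n) g d * h (n %/ d)%N.

Section MultiVariable.
Variables (K : comNzRingType) (r : nat).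
Implicit Types (F G : {ffun 'I_r -> nat} -> K) (m n a : {ffun 'I_r -> nat}).

Definition pos_tuple n : Prop := forall i, (0 < n i)%N.

(* For positive n, the duplicate-free list of all (a_1, ..., a_r) with a_i | n_i
   for every i; the bound \max_i n i only serves to range over a finite type. *)
Definition divtuples n : seq {ffun 'I_r -> nat} :=
  let T := {ffun 'I_r -> 'I_(\max_i n i).+1} in
  [seq [ffun i => nat_of_ord (a i)]
     | a : T in [pred a : T | [forall i, (a i %| n i)%N]]].

Definition mdconv F G n : K :=
  \sum_(a <- divtuples n) F a * G [ffun i => (n i %/ a i)%N].

Definition mdelta n : K := ((\prod_i n i)%N == 1%N)%:R.

Definition is_mdinverse F G : Prop :=
  forall n, pos_tuple n -> mdconv F G n = mdelta n.

Definition mmultiplicative F : Prop :=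
  (exists2 n, pos_tuple n & F n != 0) /\
  (forall m n, pos_tuple m -> pos_tuple n ->
     coprime (\prod_i m i)%N (\prod_i n i)%N ->
     F [ffun i => (m i * n i)%N] = F m * F n).

Definition psi_local (g h : nat -> K) (p : nat) (nu : {ffun 'I_r -> nat}) : K :=
  let j := (\sum_i nu i)%N in
  if [forall i, nu i == 0%N] then 1
  else if [forall i, (nu i <= 1)%N] && (2 <= j)%N
  then (-1) ^+ (j - 1) * g p * h p * dconv g h (p ^ (j - 2))%N
  else 0.

Definition is_psi (g h : nat -> K) (psi : {ffun 'I_r -> nat} -> K) : Prop :=
  mmultiplicative psi /\
  (forall p (nu : {ffun 'I_r -> nat}), prime p ->
     psi [ffun i => (p ^ nu i)%N] = psi_local g h p nu).

Lemma divtuplesP n a : pos_tuple n ->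
  (a \in divtuples n) = [forall i, (a i %| n i)%N].
Proof.
move=> n0; apply/imageP/forallP => [[b /forallP bn ->] i|an].
  by rewrite ffunE.
have ub i : (a i < (\max_i n i).+1)%N.
  by rewrite ltnS (leq_trans (dvdn_leq (n0 i) (an i))) ?leq_bigmax.
exists [ffun i => Ordinal (ub i)]; last by apply/ffunP=> i; rewrite !ffunE.
by apply/forallP => i; rewrite ffunE; exact: an.
Qed.

Lemma divtuples_uniq n : uniq (divtuples n).
Proof.
rewrite /divtuples /image_mem map_inj_uniq ?enum_uniq // => a b /ffunP ab.
by apply/ffunP => i; apply/val_inj; have := ab i; rewrite !ffunE.
Qed.

Lemma mmultiplicative_exists (L : nat -> {ffun 'I_r -> nat} -> K) :
  (forall p (nu : {ffun 'I_r -> nat}), (forall i, nu i = 0%N) -> L p nu = 1) ->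
  exists F, mmultiplicative F /\
    (forall p (nu : {ffun 'I_r -> nat}), prime p ->
       F [ffun i => (p ^ nu i)%N] = L p nu).
Proof.
move=> L1.
pose F n := \prod_(p <- primes (\prod_i n i)%N) L p [ffun i => logn p (n i)].
have prod0 n : pos_tuple n -> (0 < \prod_i n i)%N by move=> n0; exact: prodn_gt0.
have lognN n p : pos_tuple n -> p \notin primes (\prod_i n i)%N ->
    forall i, logn p (n i) = 0%N.
  move=> n0 pn i; rewrite lognE; case: ifP => // /and3P[pp _ pni].
  case/negP: pn; rewrite mem_primes pp prod0 //=.
  by rewrite (bigD1 i) //= dvdn_mulr.
have FE n s : pos_tuple n -> uniq s ->
    {subset primes (\prod_i n i)%N <= s} ->
    F n = \prod_(p <- s) L p [ffun i => logn p (n i)].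
  move=> n0 us sub.
  rewrite [RHS](bigID (mem (primes (\prod_i n i)%N))) /=.
  rewrite [X in _ * X]big1 ?mulr1 => [|p pn]; last first.
    by apply: L1 => i; rewrite ffunE lognN.
  rewrite -big_filter; apply: perm_big; apply: uniq_perm.
  - exact: primes_uniq.
  - exact: filter_uniq.
  by move=> p; rewrite mem_filter /=; case: (boolP (p \in _)) => // /sub ->.
exists F; split; first split.
- exists [ffun=> 1%N]; first by move=> i; rewrite ffunE.
  rewrite /F (_ : \prod_i _ = 1)%N ?big_nil ?oner_neq0 //.
  by apply: big1 => i _; rewrite ffunE.
- move=> m n m0 n0 cop.
  have mn0 : pos_tuple [ffun i => (m i * n i)%N].
    by move=> i; rewrite ffunE muln_gt0 m0 n0.
  have mnE : (\prod_i [ffun i => (m i * n i)%N] i =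
      (\prod_i m i) * (\prod_i n i))%N.
    by rewrite -big_split /=; apply: eq_bigr => i _; rewrite ffunE.
  pose s := primes (\prod_i m i)%N ++ primes (\prod_i n i)%N.
  have dis p : p \in primes (\prod_i m i)%N -> p \notin primes (\prod_i n i)%N.
    move=> pm; apply/negP=> pn; move: cop.
    by rewrite coprime_has_primes ?prod0 // => /hasPn/(_ p pn); rewrite /= pm.
  have us : uniq s.
    rewrite cat_uniq !primes_uniq andbT /=.
    by apply/hasPn => p pn; apply/negP => /dis; rewrite pn.
  rewrite (FE _ s mn0 us) => [|p]; last first.
    by rewrite mnE primesM ?prod0 // mem_cat.
  rewrite big_cat /=; congr (_ * _); apply: eq_big_seq => p pp.
  + congr (L p _); apply/ffunP=> i; rewrite !ffunE lognM ?m0 ?n0 //.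
    by rewrite (lognN n) ?addn0 // dis.
  + congr (L p _); apply/ffunP=> i; rewrite !ffunE lognM ?m0 ?n0 //.
    by rewrite (lognN m) //; apply/negP => /dis; rewrite pp.
- move=> p nu pp.
  rewrite (FE _ [:: p]) => [||//|q].
  + rewrite big_seq1; congr (L p _).
    by apply/ffunP => i; rewrite !ffunE pfactorK.
  + by move=> i; rewrite ffunE expn_gt0 prime_gt0.
  rewrite inE mem_primes => /and3P[qp _].
  rewrite (eq_bigr (fun i => (p ^ nu i)%N)) => [|i _]; last by rewrite ffunE.
  by rewrite -expn_sum Euclid_dvdX // dvdn_prime2 // => /andP[].
Qed.

Lemma psi_exists (g h : nat -> K) : exists psi, is_psi g h psi.
Proof.
apply: mmultiplicative_exists => p nu nu0; rewrite /psi_local ifT //.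
by apply/forallP => i; rewrite nu0.
Qed.

End MultiVariable.

Lemma mdinverse_exists (K : fieldType) (r : nat)
    (F : {ffun 'I_r -> nat} -> K) :
  F [ffun=> 1%N] != 0 -> exists G, is_mdinverse F G.
Proof.
move=> F1.
pose q (n a : {ffun 'I_r -> nat}) : {ffun 'I_r -> nat} := [ffun i => (n i %/ a i)%N].
pose one : {ffun 'I_r -> nat} := [ffun=> 1%N].
pose step (H : {ffun 'I_r -> nat} -> K) n : K :=
  (mdelta K n - \sum_(a <- divtuples n | a != one) F a * H (q n a)) / F one.
pose G k := iter k step (fun=> 0).
have qpos n a : pos_tuple n -> a \in divtuples n -> pos_tuple (q n a).
  move=> n0; rewrite divtuplesP // => /forallP an i; rewrite ffunE divn_gt0.
    exact: dvdn_leq.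
  exact: dvdn_gt0 (an i).
have qlt n a : pos_tuple n -> a \in divtuples n -> a != one ->
    (\sum_i q n a i < \sum_i n i)%N.
  move=> n0 an a1; have := an; rewrite divtuplesP // => /forallP ad.
  have [i ai] : exists i, a i != 1%N.
    apply/existsP; rewrite -negb_forall; apply: contra a1 => /forallP a1.
    by apply/eqP/ffunP => i; rewrite ffunE; apply/eqP.
  have le j : (q n a j <= n j)%N by rewrite ffunE leq_div.
  rewrite (bigD1 i) //= [X in (_ < X)%N](bigD1 i) //= -addSn leq_add ?leq_sum //.
  rewrite ffunE ltn_Pdiv // ltn_neqAle eq_sym ai /=.
  exact: dvdn_gt0 (ad i).
have fuel k : forall l n, pos_tuple n -> (\sum_i n i < k)%N ->
    (\sum_i n i < l)%N -> G k n = G l n.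
  elim: k => // k IH [//|l] n n0 nk nl /=; congr ((_ - _) / _).
  rewrite big_seq_cond [RHS]big_seq_cond; apply: eq_bigr => a /andP[an a1].
  have lt := qlt _ _ n0 an a1; rewrite (IH l) //; first exact: qpos.
  - exact: leq_trans lt _.
  - exact: leq_trans lt _.
exists (fun n : {ffun 'I_r -> nat} => G (\sum_i n i)%N.+1 n) => n n0; rewrite /mdconv.
have one_in : one \in divtuples n.
  by rewrite divtuplesP //; apply/forallP => i; rewrite ffunE dvd1n.
rewrite (bigD1_seq one) ?divtuples_uniq //=.
have -> : [ffun i => (n i %/ one i)%N] = n.
  by apply/ffunP => i; rewrite !ffunE divn1.
rewrite mulrC {1}/step divfK // -/(G _).
rewrite [X in _ - X]big_seq_cond [X in _ + X]big_seq_cond.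
rewrite [X in _ - X](eq_bigr (fun a => F a * G (\sum_i q n a i)%N.+1 (q n a))) ?subrK //.
move=> a /andP[an a1]; congr (_ * _); apply: fuel => //; [exact: qpos|exact: qlt].
Qed.

Lemma psi_inverse_exists (K : fieldType) (r : nat) (g h : nat -> K)
    (psi : {ffun 'I_r -> nat} -> K) :
  is_psi g h psi -> exists psi_inv, is_mdinverse psi psi_inv.
Proof.
case=> _ /(_ 2%N [ffun=> 0%N] isT) psi1; apply: mdinverse_exists.
rewrite (_ : [ffun=> 1%N] = [ffun i => (2 ^ [ffun=> 0] i)%N]); last first.
  by apply/ffunP => i; rewrite !ffunE.
rewrite psi1 /psi_local ifT ?oner_neq0 //.
by apply/forallP => i; rewrite ffunE.
Qed.

(* Main.v *)
Require Import Defs.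
From HB Require Import structures.
From mathcomp Require Import all_boot all_order all_algebra.
From mathcomp Require Import reals complex ring.
Local Open Scope ring_scope.

(* Both sides of the first identity are multiplicative in n, so it suffices to
   compare them at tuples of powers of one prime p.  Put x = g p, y = h p and
   F k = f (p ^ k) = \sum_(i <= k) x ^ i y ^ (k - i), with F (-1) = 0.  Then
   x ^ k = F k - y F (k - 1) and y ^ k = F k - x F (k - 1).  Multiplying these
   over k = nu_1, ..., nu_r and expanding gives, for N = \sum_i nu_i,
     (x - y) F N = x ^ (N + 1) - y ^ (N + 1)
       = \sum_S (x (- y) ^ |S| - y (- x) ^ |S|)
           \prod_(i in S) F (nu_i - 1) \prod_(i notin S) F nu_i,
   and the coefficient of S is x - y times the value of psi at the indicator
   tuple of S.  The second identity is the first one convolved with the inverse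
   of psi. *)

Set Implicit Arguments.
Unset Strict Implicit.
Unset Printing Implicit Defensive.
Import GRing.Theory.

(** * The identity at powers of one prime *)

(* [f (p ^ k)] for [x = g p], [y = h p]. *)
Definition hsum (K : comNzRingType) (x y : K) (k : nat) : K :=
  \sum_(i < k.+1) x ^+ i * y ^+ (k - i).

(* [f (p ^ (k - 1))], read as [0] when [k = 0]. *)
Definition hsum_pred (K : comNzRingType) (x y : K) (k : nat) : K :=
  if k is k'.+1 then hsum x y k' else 0.

(* The value of [psi] at a tuple with [j] entries [p] and the others [1]. *)
Definition psi_coef (K : comNzRingType) (x y : K) (j : nat) : K :=
  if j is j'.+2 then (-1) ^+ j'.+1 * x * y * hsum x y j' else (j == 0%N)%:R.

Lemma hsumC (K : comNzRingType) (x y : K) k : hsum x y k = hsum y x k.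
Proof.
rewrite /hsum [RHS](reindex_inj rev_ord_inj) /=; apply: eq_bigr => i _.
by rewrite subSS subKn 1?mulrC // -ltnS.
Qed.

Lemma hsumS (K : comNzRingType) (x y : K) k :
  hsum x y k.+1 = x ^+ k.+1 + y * hsum x y k.
Proof.
rewrite /hsum big_ord_recr /= subnn expr0 mulr1 addrC; congr (_ + _).
rewrite mulr_sumr; apply: eq_bigr => i _; rewrite subSn -1?ltnS //.
by rewrite exprS mulrCA.
Qed.

(** The [hsum_pred] term comes first so that, once a product of such sums is expanded by
    [bigA_distr], [S] is the set of indices where it is chosen. *)
Lemma expr_hsum (K : comNzRingType) (x y : K) k :
  x ^+ k = - y * hsum_pred x y k + hsum x y k.
Proof.
case: k => [|k]; first by rewrite /hsum big_ord1 !expr0 mulr0 add0r mulr1.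
by rewrite hsumS /=; ring.
Qed.

Lemma subrXX_hsum (K : comNzRingType) (x y : K) k :
  (x - y) * hsum x y k = x ^+ k.+1 - y ^+ k.+1.
Proof.
rewrite subrXX; congr (_ * _); rewrite hsumC; apply: eq_bigr => i _.
by rewrite mulrC.
Qed.

(** For [j >= 2] the right side is [(-1) ^ (j - 1) * x * y * (x ^ (j - 1) - y ^ (j - 1))], and
    [subrXX_hsum] factors the last difference. At [j = 1] the two terms cancel, at [j = 0] they give
    [x - y]. *)
Lemma psi_coefE (K : comNzRingType) (x y : K) j :
  (x - y) * psi_coef x y j = x * (- y) ^+ j - y * (- x) ^+ j.
Proof.
case: j => [|[|j]] /=; rewrite ?expr0 ?expr1; try ring.
rewrite -[LHS]/((x - y) * ((-1) ^+ j.+1 * x * y * hsum x y j)).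
rewrite mulrCA subrXX_hsum (exprNn x) (exprNn y) !exprS.
ring.
Qed.

Lemma expr_sum_hsum (K : comNzRingType) (I : finType) (nu : I -> nat) (x y : K) :
  x ^+ (\sum_i nu i)%N = \sum_(S : {set I}) (- y) ^+ #|S| *
    \prod_i (if i \in S then hsum_pred x y (nu i) else hsum x y (nu i)).
Proof.
rewrite expr_sum; under eq_bigr => i _ do rewrite (expr_hsum x y).
rewrite bigA_distr; apply: eq_big => [S|S _]; first by rewrite inE.
have -> : (- y) ^+ #|S| = \prod_i (if i \in S then - y else 1).
  by rewrite -big_mkcond prodr_const.
rewrite -big_split /=; apply: eq_bigr => i _.
by case: ifP; rewrite ?mul1r.
Qed.

(** An integral domain is enough to cancel [x - y], and this generality lets [hsum_sum] apply the
    lemma over [{poly K}]. *)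
Lemma hsum_sum_neq (K : idomainType) (I : finType) (nu : I -> nat) (x y : K) :
  x != y ->
  hsum x y (\sum_i nu i)%N = \sum_(S : {set I}) psi_coef x y #|S| *
    \prod_i (if i \in S then hsum_pred x y (nu i) else hsum x y (nu i)).
Proof.
rewrite -subr_eq0 => /mulfI; apply.
rewrite subrXX_hsum mulr_sumr !exprS (expr_sum_hsum nu x y).
rewrite (expr_sum_hsum nu y x) !mulr_sumr -sumrB.
apply: eq_bigr => S _; rewrite [RHS]mulrA psi_coefE mulrBl !mulrA.
(* The expansion of the power of [y] has [x] and [y] exchanged; its products are the same because
   [hsum] is symmetric. *)
congr (_ - _ * _); apply: eq_bigr => i _.
by case: (nu i) => [|k] /=; rewrite ?(hsumC y x).
Qed.

(** This and the next two lemmas transport the identity from [{poly K}] to [K] along evaluation at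
    0. *)
Lemma rmorph_hsum (K L : comNzRingType) (phi : {rmorphism K -> L}) x y k :
  phi (hsum x y k) = hsum (phi x) (phi y) k.
Proof. by rewrite rmorph_sum; apply: eq_bigr => i _; rewrite rmorphM !rmorphXn. Qed.

Lemma rmorph_hsum_pred (K L : comNzRingType) (phi : {rmorphism K -> L}) x y k :
  phi (hsum_pred x y k) = hsum_pred (phi x) (phi y) k.
Proof. by case: k => [|k] /=; rewrite ?rmorph0 ?rmorph_hsum. Qed.

Lemma rmorph_psi_coef (K L : comNzRingType) (phi : {rmorphism K -> L}) x y j :
  phi (psi_coef x y j) = psi_coef (phi x) (phi y) j.
Proof.
case: j => [|[|j]] /=; rewrite ?rmorph1 ?rmorph0 //.
by rewrite !rmorphM rmorph_hsum rmorphXn rmorphN1.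
Qed.

(* The identity is polynomial in [x] and [y]: deforming [x] to [x + 'X]
   separates the two arguments, and the case [x = y] follows at ['X = 0]. *)
Lemma hsum_sum (K : idomainType) (I : finType) (nu : I -> nat) (x y : K) :
  hsum x y (\sum_i nu i)%N = \sum_(S : {set I}) psi_coef x y #|S| *
    \prod_i (if i \in S then hsum_pred x y (nu i) else hsum x y (nu i)).
Proof.
have neq : 'X + x%:P != y%:P.
  apply/eqP => /(congr1 (fun q : {poly K} => q`_1)) /eqP.
  by rewrite coefD coefX !coefC /= addr0 oner_eq0.
have := congr1 (horner_eval 0) (hsum_sum_neq nu neq).
rewrite rmorph_hsum rmorph_sum /= /horner_eval !hornerE => ->.
apply: eq_bigr => S _; rewrite -!/(horner_eval _ _) rmorphM rmorph_psi_coef rmorph_prod.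
rewrite /= /horner_eval !hornerE; congr (_ * _); apply: eq_bigr => i _.
by rewrite -!/(horner_eval _ _); case: ifP => _;
  rewrite ?rmorph_hsum ?rmorph_hsum_pred /= /horner_eval !hornerE.
Qed.

(** * Divisors of a product of two coprime numbers *)

(** Together with [coprime_gcdnM], this makes [c |-> (gcdn c m, gcdn c n)] the inverse of
    [(a, b) |-> a * b] between divisors of [m * n] and pairs of divisors. *)
Lemma coprime_gcdn_mul m n c : coprime m n -> (c %| m * n)%N ->
  (gcdn c m * gcdn c n)%N = c.
Proof.
move=> cop cmn; apply/eqP; rewrite eqn_dvd; apply/andP; split.
  rewrite Gauss_dvd ?dvdn_gcdl //.
  by apply: coprime_dvdl (dvdn_gcdr c m) _; apply: coprime_dvdr (dvdn_gcdr c n) _.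
rewrite muln_gcdr dvdn_gcd dvdn_mull //= muln_gcdl dvdn_gcd cmn andbT.
exact: dvdn_mulr.
Qed.

Lemma coprime_gcdnM m n a b : coprime m n -> (a %| m)%N -> (b %| n)%N ->
  gcdn (a * b) m = a.
Proof.
move=> cop am bn; rewrite gcdnC Gauss_gcdl; first by apply/gcdn_idPr.
exact: coprime_dvdr bn cop.
Qed.

Lemma divn_mulMM m n a b : (a %| m)%N -> (b %| n)%N ->
  (m * n %/ (a * b) = (m %/ a) * (n %/ b))%N.
Proof.
move=> /dvdnP[k ->] /dvdnP[l ->]; rewrite mulnACA.
case: (posnP a) => [-> | a0]; first by rewrite !(mul0n, muln0, divn0).
case: (posnP b) => [-> | b0]; first by rewrite !(muln0, divn0).
by rewrite !mulnK // muln_gt0 a0.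
Qed.

(** * Dirichlet convolution in one variable *)

Section OneVariable.
Variable K : fieldType.
Implicit Types g h : nat -> K.

Lemma cmul1 g : completely_multiplicative g -> g 1%N = 1.
Proof.
case=> [[n n0 gn] gM]; have := gM n 1%N n0 isT.
by rewrite muln1 -{1}[g n]mulr1 => /(mulfI gn).
Qed.

Lemma cmulX g p k : completely_multiplicative g -> (0 < p)%N ->
  g (p ^ k)%N = g p ^+ k.
Proof.
move=> cg p0; elim: k => [|k IH]; first by rewrite cmul1.
by rewrite expnS cg.2 ?expn_gt0 ?p0 // IH exprS.
Qed.

Lemma dconvM g h m n :
  completely_multiplicative g -> completely_multiplicative h ->
  (0 < m)%N -> (0 < n)%N -> coprime m n ->
  dconv g h (m * n)%N = dconv g h m * dconv g h n.
Proof.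
move=> [_ gM] [_ hM] m0 n0 cop.
have perm : perm_eq (divisors (m * n))
    [seq (a * b)%N | a <- divisors m, b <- divisors n].
  apply: uniq_perm; first exact: divisors_uniq.
    apply: allpairs_uniq; rewrite ?divisors_uniq // => -[a b] [a' b'] /=.
    move=> /allpairsP[[? ?] /= [+ + [-> ->]]] /allpairsP[[? ?] /= [+ + [-> ->]]].
    rewrite -!dvdn_divisors // => am bn am' bn' E; congr (_, _).
      by rewrite -(coprime_gcdnM cop am bn) E (coprime_gcdnM cop am' bn').
    rewrite coprime_sym in cop.
    by rewrite -(coprime_gcdnM cop bn am) mulnC E mulnC (coprime_gcdnM cop bn' am').
  move=> c; rewrite -dvdn_divisors ?muln_gt0 ?m0 //; apply/idP/allpairsP.
    move=> cmn; exists (gcdn c m, gcdn c n).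
    by rewrite /= -!dvdn_divisors // !dvdn_gcdr coprime_gcdn_mul.
  by case=> [[a b] /= [+ + ->]]; rewrite -!dvdn_divisors // => *; exact: dvdn_mul.
rewrite /dconv (perm_big _ perm) /= big_allpairs_dep /= mulr_suml.
apply: eq_big_seq => a; rewrite -dvdn_divisors // => am; rewrite mulr_sumr.
apply: eq_big_seq => b; rewrite -dvdn_divisors // => bn.
have [a0 b0] := (dvdn_gt0 m0 am, dvdn_gt0 n0 bn).
rewrite divn_mulMM // gM // hM ?divn_gt0 ?(dvdn_leq _ am) ?(dvdn_leq _ bn) //.
by rewrite mulrACA.
Qed.

End OneVariable.

(** * Algebra of the convolution in several variables *)

Section MultiVariable.
Variables (K : comNzRingType) (r : nat).
Implicit Types (F G H : {ffun 'I_r -> nat} -> K) (m n a b c : {ffun 'I_r -> nat}).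

Definition tmul a b : {ffun 'I_r -> nat} := [ffun i => a i * b i]%N.
Definition tdiv n a : {ffun 'I_r -> nat} := [ffun i => n i %/ a i]%N.

Lemma mem_divtuples n a : pos_tuple n ->
  reflect (forall i, (a i %| n i)%N) (a \in divtuples n).
Proof. by move=> n0; rewrite divtuplesP //; exact: forallP. Qed.

Lemma pos_tuple_dvd n a : pos_tuple n -> a \in divtuples n -> pos_tuple a.
Proof. by move=> n0 /(mem_divtuples _ n0) an i; exact: dvdn_gt0 (an i). Qed.

Lemma pos_tuple_div n a : pos_tuple n -> a \in divtuples n -> pos_tuple (tdiv n a).
Proof.
move=> n0 an i; rewrite ffunE divn_gt0 ?(pos_tuple_dvd n0 an) //.
by move/(mem_divtuples _ n0): an => an; exact: dvdn_leq.
Qed.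

Lemma tdiv_divtuples n a : pos_tuple n -> a \in divtuples n ->
  tdiv n a \in divtuples n.
Proof.
move=> n0 /(mem_divtuples _ n0) an; apply/mem_divtuples => // i.
by rewrite ffunE dvdn_divLR ?dvdn_mulr // (dvdn_gt0 (n0 i)).
Qed.

Lemma tdivK n a : pos_tuple n -> a \in divtuples n -> tdiv n (tdiv n a) = a.
Proof.
move=> n0 /(mem_divtuples _ n0) an; apply/ffunP => i.
by rewrite !ffunE divnA // mulKn.
Qed.

Lemma tdiv_inj n : pos_tuple n -> {in divtuples n &, injective (tdiv n)}.
Proof. by move=> n0; apply: can_in_inj => a; exact: tdivK. Qed.

(** The involution [a |-> tdiv n a] permutes the divisor tuples of [n]. *)
Lemma mdconvC F G n : pos_tuple n -> mdconv F G n = mdconv G F n.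
Proof.
move=> n0; rewrite /mdconv.
have perm : perm_eq (divtuples n) (map (tdiv n) (divtuples n)).
  apply: uniq_perm; first exact: divtuples_uniq.
    by rewrite map_inj_in_uniq ?divtuples_uniq //; exact: tdiv_inj.
  move=> a; apply/idP/mapP => [an | [b bn ->]]; last exact: tdiv_divtuples.
  by exists (tdiv n a); rewrite ?tdivK ?tdiv_divtuples.
rewrite (perm_big _ perm) /= big_map; apply: eq_big_seq => a an.
by rewrite -/(tdiv _ _) tdivK // mulrC.
Qed.

(** Both sides are the sum of [F a * G (c / a) * H (n / c)] over chains [a | c | n]. *)
Lemma mdconvA F G H n : pos_tuple n ->
  mdconv F (mdconv G H) n = mdconv (mdconv F G) H n.
Proof.
move=> n0; rewrite /mdconv.
pose dvd a c := [forall i, (a i %| c i)%N].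
transitivity (\sum_(a <- divtuples n) \sum_(c <- divtuples n | dvd a c)
    F a * G (tdiv c a) * H (tdiv n c)).
  apply: eq_big_seq => a an; rewrite -/(tdiv n a) mulr_sumr.
  have a0 := pos_tuple_dvd n0 an; have q0 := pos_tuple_div n0 an.
  (* For fixed [a], the intermediate tuples are [c = a b] with [b] dividing [n / a]. *)
  have perm : perm_eq [seq c <- divtuples n | dvd a c]
      (map (tmul a) (divtuples (tdiv n a))).
    apply: uniq_perm; first by rewrite filter_uniq ?divtuples_uniq.
      rewrite map_inj_uniq ?divtuples_uniq // => b b' /ffunP E; apply/ffunP => i.
      by have /eqP := E i; rewrite !ffunE eqn_pmul2l // => /eqP.
    move=> c; rewrite mem_filter; apply/andP/mapP.
      case=> [/forallP ac /(mem_divtuples _ n0) cn]; exists (tdiv c a).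
        apply/mem_divtuples => // i; rewrite !ffunE.
        by rewrite dvdn_divRL ?divnK // (dvdn_trans (ac i)).
      by apply/ffunP => i; rewrite !ffunE mulnC divnK.
    case=> b /(mem_divtuples _ q0) bn ->; split.
      by apply/forallP => i; rewrite ffunE dvdn_mulr.
    apply/mem_divtuples => // i; rewrite ffunE mulnC -dvdn_divRL //.
      by have := bn i; rewrite ffunE.
    exact/mem_divtuples.
  rewrite -[RHS]big_filter (perm_big _ perm) /= big_map; apply: eq_big_seq => b bn.
  rewrite mulrA; congr (_ * G _ * H _); apply/ffunP => i; rewrite !ffunE.
    by rewrite mulKn.
  by rewrite divnMA.
rewrite (exchange_big_dep predT) //=; apply: eq_big_seq => c cn.
have c0 := pos_tuple_dvd n0 cn.
(* For fixed [c] dividing [n], the divisor tuples of [n] that divide [c] are exactly those of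
   [c]. *)
rewrite mulr_suml -[LHS]big_filter; apply: perm_big; apply: uniq_perm.
- by rewrite filter_uniq ?divtuples_uniq.
- exact: divtuples_uniq.
move=> a; rewrite mem_filter; apply/andP/mem_divtuples => // [[/forallP //]|ac].
split; first exact/forallP.
by apply/mem_divtuples => // i; apply: dvdn_trans (ac i) _; exact/mem_divtuples.
Qed.

Lemma mdconv1f F n : pos_tuple n -> mdconv (@mdelta K r) F n = F n.
Proof.
move=> n0; rewrite /mdconv (bigD1_seq [ffun=> 1%N]) ?divtuples_uniq //=; last first.
  by apply/mem_divtuples => // i; rewrite ffunE dvd1n.
rewrite big1_seq => [|a /andP[a1 _]].
  rewrite addr0 /mdelta big1 ?mul1r => [|i _]; last by rewrite ffunE.
  by congr F; apply/ffunP => i; rewrite !ffunE divn1.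
rewrite /mdelta; case: eqP => [|_]; last by rewrite mul0r.
move=> E; case/eqP: a1; apply/ffunP => i; rewrite ffunE.
by apply/eqP; rewrite -dvdn1 -E (bigD1 i) //= dvdn_mulr.
Qed.

(** Identities between functions are available at positive tuples only; this suffices, as divisor
    tuples of a positive tuple and their quotients are positive. *)
Lemma eq_mdconvr F G H n : pos_tuple n ->
  (forall m, pos_tuple m -> G m = H m) -> mdconv F G n = mdconv F H n.
Proof.
move=> n0 GH; apply: eq_big_seq => a an; congr (_ * _).
exact: GH (pos_tuple_div n0 an).
Qed.

Lemma eq_mdconvl F G H n : pos_tuple n ->
  (forall m, pos_tuple m -> F m = G m) -> mdconv F H n = mdconv G H n.
Proof.
move=> n0 FG; apply: eq_big_seq => a an; congr (_ * _).
exact: FG (pos_tuple_dvd n0 an).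
Qed.

(** * Multiplicativity in several variables *)

Definition mult_coprime F := forall m n, pos_tuple m -> pos_tuple n ->
  coprime (\prod_i m i)%N (\prod_i n i)%N -> F (tmul m n) = F m * F n.

Lemma coprime_tuple m n : coprime (\prod_i m i)%N (\prod_i n i)%N ->
  forall i, coprime (m i) (n i).
Proof.
move=> cop i; apply: (@coprime_dvdl _ (\prod_i m i)%N).
  by rewrite (bigD1 i) //= dvdn_mulr.
by apply: coprime_dvdr cop; rewrite (bigD1 i) //= dvdn_mulr.
Qed.

Lemma dvdn_prod_tuple n a : pos_tuple n -> a \in divtuples n ->
  (\prod_i a i %| \prod_i n i)%N.
Proof.
move=> n0 /(mem_divtuples _ n0) an.
by apply: (big_ind2 (fun x y => x %| y)%N) => // *; exact: dvdn_mul.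
Qed.

Lemma prod_tdiv n a : pos_tuple n -> a \in divtuples n ->
  (\prod_i tdiv n a i = (\prod_i n i) %/ \prod_i a i)%N.
Proof.
move=> n0 an; have a0 := pos_tuple_dvd n0 an.
rewrite -[X in (X %/ _)%N](_ : \prod_i tdiv n a i * \prod_i a i = _)%N.
  by rewrite mulnK // prodn_gt0.
rewrite -big_split /=; apply: eq_bigr => i _; rewrite ffunE divnK //.
exact/mem_divtuples.
Qed.

(** Coprimality of the products gives coprimality in each component, so divisor tuples of [tmul m n]
    split uniquely as [tmul a b], with componentwise gcds as inverse. Each summand then factors. *)
Lemma mdconv_mult F G : mult_coprime F -> mult_coprime G ->
  mult_coprime (mdconv F G).
Proof.
move=> FM GM m n m0 n0 cop; have copi := coprime_tuple cop.
have mn0 : pos_tuple (tmul m n) by move=> i; rewrite ffunE muln_gt0 m0 n0.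
have perm : perm_eq (divtuples (tmul m n))
    [seq tmul a b | a <- divtuples m, b <- divtuples n].
  apply: uniq_perm; first exact: divtuples_uniq.
    apply: allpairs_uniq; rewrite ?divtuples_uniq // => -[a b] [a' b'] /=.
    move=> /allpairsP[[? ?] /= [+ + [-> ->]]] /allpairsP[[? ?] /= [+ + [-> ->]]].
    move=> /(mem_divtuples _ m0) am /(mem_divtuples _ n0) bn.
    move=> /(mem_divtuples _ m0) am' /(mem_divtuples _ n0) bn' /ffunP E.
    congr (_, _); apply/ffunP => i; have := E i; rewrite !ffunE => Ei.
      by rewrite -(coprime_gcdnM (copi i) (am i) (bn i)) Ei (coprime_gcdnM (copi i)).
    have cop' := copi i; rewrite coprime_sym in cop'.
    by rewrite -(coprime_gcdnM cop' (bn i) (am i)) mulnC Ei mulnC (coprime_gcdnM cop').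
  move=> c; apply/mem_divtuples/allpairsP => // [cmn|].
    exists ([ffun i => gcdn (c i) (m i)], [ffun i => gcdn (c i) (n i)]); split => /=.
    - by apply/mem_divtuples => // i; rewrite ffunE dvdn_gcdr.
    - by apply/mem_divtuples => // i; rewrite ffunE dvdn_gcdr.
    by apply/ffunP => i; have := cmn i; rewrite !ffunE => /(coprime_gcdn_mul (copi i)).
  case=> [[a b] /= [/(mem_divtuples _ m0) am /(mem_divtuples _ n0) bn ->]] i.
  by rewrite !ffunE dvdn_mul.
rewrite /mdconv (perm_big _ perm) /= big_allpairs_dep /= mulr_suml.
apply: eq_big_seq => a am; rewrite mulr_sumr; apply: eq_big_seq => b bn.
rewrite -!/(tdiv _ _).
have -> : tdiv (tmul m n) (tmul a b) = tmul (tdiv m a) (tdiv n b).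
  by apply/ffunP => i; rewrite !ffunE divn_mulMM //; exact/mem_divtuples.
rewrite FM ?GM.
- by rewrite mulrACA.
- exact: pos_tuple_div.
- exact: pos_tuple_div.
- apply: coprime_dvdl (dvdn_prod_tuple m0 (tdiv_divtuples m0 am)) _.
  exact: coprime_dvdr (dvdn_prod_tuple n0 (tdiv_divtuples n0 bn)) _.
- exact: pos_tuple_dvd am.
- exact: pos_tuple_dvd bn.
apply: coprime_dvdl (dvdn_prod_tuple m0 am) _.
exact: coprime_dvdr (dvdn_prod_tuple n0 bn) _.
Qed.

(** Strong induction on the product of the entries: for a prime [p] dividing it, [n] is the tuple of
    [p]-parts times the tuple of [p']-parts, and the latter has a smaller product. *)
Lemma mult_coprime_ext F G : mult_coprime F -> mult_coprime G ->
  (forall p (nu : {ffun 'I_r -> nat}), prime p ->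
     F [ffun i => p ^ nu i]%N = G [ffun i => p ^ nu i]%N) ->
  forall n, pos_tuple n -> F n = G n.
Proof.
move=> FM GM FG n; have [k] := ubnP (\prod_i n i)%N.
elim: k n => // k IH n nk n0.
have P0 : (0 < \prod_i n i)%N by exact: prodn_gt0.
case: (leqP (\prod_i n i)%N 1) => P1.
  (* The all-ones tuple consists of zeroth powers of the prime 2, so [FG] covers it. *)
  have -> : n = [ffun i => 2 ^ ([ffun=> 0%N] : {ffun 'I_r -> nat}) i]%N.
    apply/ffunP => i; rewrite !ffunE; apply/eqP; rewrite -dvdn1.
    have -> : 1%N = (\prod_i n i)%N by apply/eqP; rewrite eqn_leq P0 P1.
    by rewrite (bigD1 i) //= dvdn_mulr.
  exact: FG.
pose p := pdiv (\prod_i n i)%N; have pp : prime p by exact: pdiv_prime.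
pose np : {ffun 'I_r -> nat} := [ffun i => (n i)`_p]%N.
pose nq : {ffun 'I_r -> nat} := [ffun i => (n i)`_p^']%N.
have part pi : (\prod_i (n i)`_pi = (\prod_i n i)`_pi)%N.
  (* [partnM] asks for positive factors, so positivity is carried through the induction on the
     product. *)
  suff [] : (\prod_i (n i)`_pi = (\prod_i n i)`_pi)%N /\ (0 < \prod_i n i)%N by [].
  elim/big_ind2: _ => [|x x' y y' [-> x0] [-> y0]|i _]; rewrite ?partn1 //.
  by rewrite partnM // muln_gt0 x0.
have Ep : (\prod_i np i = (\prod_i n i)`_p)%N.
  by rewrite -part; apply: eq_bigr => i _; rewrite ffunE.
have Eq : (\prod_i nq i = (\prod_i n i)`_p^')%N.
  by rewrite -part; apply: eq_bigr => i _; rewrite ffunE.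
have -> : n = tmul np nq by apply/ffunP => i; rewrite !ffunE partnC.
have np0 : pos_tuple np by move=> i; rewrite ffunE part_gt0.
have nq0 : pos_tuple nq by move=> i; rewrite ffunE part_gt0.
have cop : coprime (\prod_i np i)%N (\prod_i nq i)%N by rewrite Ep Eq coprime_partC.
rewrite FM // GM //; congr (_ * _).
  have -> : np = [ffun i => p ^ ([ffun j => logn p (n j)] : {ffun 'I_r -> nat}) i]%N.
    by apply/ffunP => i; rewrite !ffunE p_part.
  exact: FG.
apply: IH => //; rewrite Eq -ltnS; apply: leq_trans nk.
rewrite -[X in (_ < X.+1)%N](partnC p) // ltnS.
rewrite -[X in (X < _)%N]mul1n ltn_pmul2r ?part_gt0 //.
by rewrite p_part_gt1 pi_pdiv.
Qed.

End MultiVariable.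

(** * The two identities for [psi] *)

Section BuscheRamanujan.
Variables (K : fieldType) (g h : nat -> K).
Hypotheses (cg : completely_multiplicative g) (ch : completely_multiplicative h).

Lemma dconv_pfactor p k : prime p -> dconv g h (p ^ k)%N = hsum (g p) (h p) k.
Proof.
move=> pp; have p0 := prime_gt0 pp.
have perm : perm_eq (divisors (p ^ k)) [seq (p ^ i)%N | i : 'I_k.+1].
  apply: uniq_perm; first exact: divisors_uniq.
    rewrite map_inj_uniq ?enum_uniq // => i j /eqP.
    by rewrite eqn_exp2l ?prime_gt1 // => /eqP/val_inj.
  move=> d; rewrite -dvdn_divisors ?expn_gt0 ?p0 //.
  apply/(dvdn_pfactor _ _ pp)/mapP => [[i ik ->]|[i _ ->]].
    by exists (inord i); rewrite ?mem_enum // inordK.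
  by exists (i : nat); rewrite // -ltnS.
rewrite /dconv (perm_big _ perm) /= big_image; apply: eq_bigr => i _.
by rewrite -expnB // -1?ltnS // !cmulX.
Qed.

Variable r : nat.
Implicit Types n a nu : {ffun 'I_r -> nat}.

Let fprod n := \prod_i dconv g h (n i).

Lemma mult_coprime_dconv_prod :
  mult_coprime (fun n : {ffun 'I_r -> nat} => dconv g h (\prod_i n i)%N).
Proof.
move=> m n m0 n0 cop; rewrite -dconvM ?prodn_gt0 //; congr dconv.
by rewrite -big_split; apply: eq_bigr => i _; rewrite ffunE.
Qed.

Lemma mult_coprime_prod_dconv : mult_coprime fprod.
Proof.
move=> m n m0 n0 cop; rewrite -big_split; apply: eq_bigr => i _ /=.
by rewrite ffunE dconvM //; exact: coprime_tuple cop i.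
Qed.

Lemma psi_local_set p (A : {set 'I_r}) : prime p ->
  psi_local g h p [ffun i => (i \in A) : nat] = psi_coef (g p) (h p) #|A|.
Proof.
move=> pp; rewrite /psi_local.
have -> : (\sum_i [ffun i => (i \in A) : nat] i = #|A|)%N.
  by rewrite -sum1_card [RHS]big_mkcond; apply: eq_bigr => i _; rewrite ffunE; case: (i \in A).
have -> : [forall i, [ffun i => (i \in A) : nat] i == 0%N] = (#|A| == 0%N).
  rewrite cards_eq0; apply/forallP/eqP => [E|-> i]; last by rewrite ffunE inE.
  by apply/setP => i; have := E i; rewrite ffunE inE; case: (i \in A).
have -> : [forall i, ([ffun i => (i \in A) : nat] i <= 1)%N].
  by apply/forallP => i; rewrite ffunE leq_b1.
case: #|A| => [|[|j]] //=.
by rewrite dconv_pfactor // !subSS !subn0.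
Qed.

Lemma psi_local_eq0 p nu : ~~ [forall i, (nu i <= 1)%N] -> psi_local g h p nu = 0.
Proof.
move=> nu1; rewrite /psi_local (negPf nu1) /= ifF //; apply: contraNF nu1.
by move=> /forallP nu0; apply/forallP => i; rewrite (eqP (nu0 i)).
Qed.

Variable psi : {ffun 'I_r -> nat} -> K.
Hypothesis psiP : is_psi g h psi.

(** Matches the convolution with [hsum_sum] term by term: a set [A] of indices corresponds to the
    divisor tuple [t A] with entry [p] on [A] and 1 elsewhere. *)
Lemma mdconv_psi_pfactor p nu : prime p ->
  mdconv psi fprod [ffun i => p ^ nu i]%N = dconv g h (\prod_i p ^ nu i)%N.
Proof.
move=> pp; have p0 := prime_gt0 pp; have p1 := prime_gt1 pp.
rewrite -expn_sum dconv_pfactor // hsum_sum.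
set n := [ffun i => p ^ nu i]%N.
have n0 : pos_tuple n by move=> i; rewrite ffunE expn_gt0 p0.
pose t (A : {set 'I_r}) : {ffun 'I_r -> nat} := [ffun i => p ^ (i \in A)]%N.
pose supp := [set i | 0 < nu i]%N.
have tE A : t A = [ffun i => p ^ ([ffun j => (j \in A) : nat] : {ffun 'I_r -> nat}) i]%N.
  by apply/ffunP => i; rewrite !ffunE.
pose P a := [forall i, (logn p (a i) <= 1)%N].
(* Divisor tuples with some exponent at least 2 drop out, since [psi] vanishes there. *)
rewrite /mdconv (bigID P) /= [X in _ + X]big1_seq ?addr0; last first.
  move=> a /andP[Pa /(mem_divtuples _ n0) an].
  have -> : a = [ffun i => p ^ ([ffun j => logn p (a j)] : {ffun 'I_r -> nat}) i]%N.
    apply/ffunP => i; have := an i; rewrite !ffunE.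
    by move=> /(dvdn_pfactor _ _ pp)[k _ ->]; rewrite pfactorK.
  rewrite psiP.2 // psi_local_eq0 ?mul0r //; apply: contra Pa => /forallP Pa.
  by apply/forallP => i; have := Pa i; rewrite ffunE.
have perm : perm_eq [seq a <- divtuples n | P a]
    [seq t A | A in [pred A : {set 'I_r} | A \subset supp]].
  apply: uniq_perm; first by rewrite filter_uniq ?divtuples_uniq.
    rewrite map_inj_uniq ?enum_uniq // => A B /ffunP E; apply/setP => i.
    have /eqP := E i; rewrite !ffunE eqn_exp2l //.
    by case: (i \in A); case: (i \in B).
  move=> a; rewrite mem_filter; apply/andP/imageP.
    case=> /forallP Pa /(mem_divtuples _ n0) an.
    exists [set i | 0 < logn p (a i)]%N.
      apply/subsetP => i; rewrite !inE; have := an i; rewrite ffunE.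
      move=> /(dvdn_pfactor _ _ pp)[k knu ->]; rewrite pfactorK // => k0.
      exact: leq_trans k0 knu.
    apply/ffunP => i; rewrite !ffunE !inE; have := an i; have := Pa i; rewrite ffunE.
    move=> + /(dvdn_pfactor _ _ pp)[k _ E]; rewrite E pfactorK //.
    by case: k {E} => [|[|]].
  case=> A /subsetP Asupp ->; split.
    by apply/forallP => i; rewrite ffunE pfactorK // leq_b1.
  apply/mem_divtuples => // i; rewrite !ffunE dvdn_exp2l //.
  by have := Asupp i; case: (i \in A) => // /(_ isT); rewrite inE.
rewrite -big_filter (perm_big _ perm) /= big_image.
(* [t A] divides [n] exactly when [A] lies in [supp]. In [hsum_sum] the other sets contribute 0,
   because [hsum_pred] is 0 at exponent 0. *)
rewrite [RHS](bigID [pred A : {set 'I_r} | A \subset supp]) /=.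
rewrite [X in _ + X]big1 ?addr0 => [|A]; last first.
  move=> /subsetPn[i iA]; rewrite inE -eqn0Ngt => /eqP nu0.
  by rewrite (bigD1 i) //= iA nu0 mul0r mulr0.
apply: eq_bigr => A /subsetP Asupp; rewrite tE psiP.2 // psi_local_set //.
congr (_ * _); apply: eq_bigr => i _; rewrite !ffunE.
have := Asupp i; case: (i \in A) => [/(_ isT)|_].
  rewrite inE; case: (nu i) => // k _.
  by rewrite expnS expn1 mulKn // dconv_pfactor.
by rewrite expn0 divn1 dconv_pfactor.
Qed.

Lemma mdconv_psi n : pos_tuple n -> mdconv psi fprod n = dconv g h (\prod_i n i)%N.
Proof.
move: n; apply: mult_coprime_ext.
- exact: mdconv_mult psiP.1.2 mult_coprime_prod_dconv.
- exact: mult_coprime_dconv_prod.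
move=> p nu pp; rewrite mdconv_psi_pfactor //; congr dconv.
by apply: eq_bigr => i _; rewrite ffunE.
Qed.

Lemma mdconv_psi_inv psi_inv n : is_mdinverse psi psi_inv -> pos_tuple n ->
  mdconv psi_inv (fun m => dconv g h (\prod_i m i)%N) n = fprod n.
Proof.
move=> inv n0; transitivity (mdconv psi_inv (mdconv psi fprod) n).
  by apply: eq_mdconvr => // m m0; rewrite mdconv_psi.
(* [is_mdinverse] puts [psi] on the left of [psi_inv]; commutativity gives the order that arises
   here. *)
rewrite mdconvA // -[RHS]mdconv1f //; apply: eq_mdconvl => // m m0.
by rewrite mdconvC // inv.
Qed.

End BuscheRamanujan.

Theorem theorem1 (R : realType) (g h : nat -> R[i])
    (g_cmul : completely_multiplicative g)
    (h_cmul : completely_multiplicative h)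
    (r : nat) (r_gt0 : (0 < r)%N)
    (psi : {ffun 'I_r -> nat} -> R[i]) (psi_def : is_psi g h psi)
    (psi_inv : {ffun 'I_r -> nat} -> R[i])
    (psi_inv_def : is_mdinverse psi psi_inv)
    (n : {ffun 'I_r -> nat}) (n_pos : pos_tuple n) :
  dconv g h (\prod_i n i)%N =
    \sum_(a <- divtuples n) (\prod_i dconv g h (n i %/ a i)%N) * psi a
  /\
  \prod_i dconv g h (n i) =
    \sum_(a <- divtuples n)
      dconv g h ((\prod_i n i)%N %/ (\prod_i a i)%N)%N * psi_inv a.
Proof.
split.
  rewrite -(mdconv_psi g_cmul h_cmul psi_def) //; apply: eq_bigr => a _.
  by rewrite mulrC; congr (_ * _); apply: eq_bigr => i _; rewrite ffunE.
rewrite -(mdconv_psi_inv g_cmul h_cmul psi_def psi_inv_def) //.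
(* Membership of [a] is kept: [prod_tdiv] uses the divisibility of each [n i] by [a i] to exchange
   product and quotient. *)
apply: eq_big_seq => a an; rewrite mulrC; congr (dconv g h _ * _).
exact: prod_tdiv.
Qed.
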